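(* Let $n\ge1$ and $Y_1,\dots,Y_n\in[0,1]$, with order statistics $Y_{(0)}\le Y_{(1)}\le\cdots\le Y_{(n-1)}$. Then $$n\,\omega^2_{c_0}=\frac{1}{12n}+\sum_{i=0}^{n-1}\left(\frac{2i+1}{2n}-Y_{(i)}\right)^2 .$$
   Context: Here the dimension is $d=1$ and $c_0$ is the low corner of $[0,1]$. With $F_n^{c_0}(x)=\frac1n\sum_{i=1}^n\mathbf 1\{Y_i\le x\}$ and $F^{c_0}(x)=x$, define $\omega^2_{c_0}=\int_0^1(F_n^{c_0}(x)-x)^2\,dx$. The order statistics are the sample values rearranged in nondecreasing order, indexed from $0$ to $n-1$. *)

(* Defs.v *)
From HB Require Import structures.
From mathcomp Require Import all_boot all_order all_algebra.
From mathcomp Require Import all_classical all_reals all_analysis.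

Set Implicit Arguments.
Unset Strict Implicit.
Unset Printing Implicit Defensive.

Import Order.TTheory GRing.Theory Num.Theory.
Import numFieldNormedType.Exports.

Local Open Scope classical_set_scope.
Local Open Scope ring_scope.

Section CornerDiscrepancy.
Variables (R : realType) (n : nat).

(* In dimension 1 the box anchored at the low corner 0 and ending at x is
   [0, x]; a sample point of [0, 1] lies in it iff it is at most x. *)
Definition emp_cdf (Y : 'I_n -> R) (x : R) : R :=
  n%:R^-1 * \sum_(i < n) (Y i <= x)%R%:R.

Definition unif_cdf (x : R) : R := x.

Definition omega2 (Y : 'I_n -> R) : R :=
  \int[lebesgue_measure]_(x in `[0, 1]) (emp_cdf Y x - unif_cdf x) ^+ 2.

(* Ranks start at 0, and ties are kept with their multiplicity. The default
   value 0 of nth is returned only for i >= n. *)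
Definition order_stat (Y : 'I_n -> R) (i : nat) : R :=
  nth 0 (sort <=%R (codom Y)) i.

End CornerDiscrepancy.

(* Main.v *)
Require Import Defs.
From HB Require Import structures.
From mathcomp Require Import all_boot all_order all_algebra.
From mathcomp Require Import all_classical all_reals all_analysis.
From mathcomp Require Import ring.

(** For [y_0 <= ... <= y_(n-1)] the counting function
    [G x = \sum_i 1{y_i <= x}] satisfies [G^2 = \sum_i (2i+1) 1{y_i <= x}],
    because the indicators form an initial segment and the first [k] odd
    numbers sum to [k^2]. Hence [(G/n - x)^2] is [x^2] plus a linear
    combination of truncated affine functions, each integrated by the
    fundamental theorem of calculus, and the result is a polynomial identity
    in the [y_i] once [\sum_i (2i+1)^2 = n (4n^2 - 1) / 3] is used. *)

Set Implicit Arguments.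
Unset Strict Implicit.
Unset Printing Implicit Defensive.

Import Order.TTheory GRing.Theory Num.Theory.
Import numFieldNormedType.Exports.

Local Open Scope ring_scope.

Lemma sqr_sum_initial_segment (R : comPzRingType) (n : nat) (b : nat -> bool) :
  (forall i j, (i <= j < n)%N -> b j -> b i) ->
  (\sum_(i < n) (b i)%:R) ^+ 2 = \sum_(i < n) (b i)%:R * (2 * i + 1)%:R :> R.
Proof.
elim: n => [|n IHn] b_init; first by rewrite !big_ord0 expr0n.
rewrite !big_ord_recr/= sqrrD IHn; last first.
  by move=> i j /andP[ij jn]; apply: b_init; rewrite ij ltnS ltnW.
(* If [b n] fails, both sides gain 0. If it holds, all earlier indicators are 1, so the square grows
   by [2 * n + 1]. *)
rewrite -addrA; congr (_ + _); case bn : (b n); last first.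
  by rewrite mulr0 mul0rn mul0r expr0n addr0.
rewrite (eq_bigr (fun=> 1)) => [|i _]; last first.
  by rewrite (b_init i n)// ltnS leqnn andbT ltnW.
by rewrite sumr_const card_ord mulr1 mul1r expr1n natrD natrM mulr_natl.
Qed.

Lemma sum_sqr_odd (R : realFieldType) (n : nat) :
  \sum_(i < n) (2 * i + 1)%:R ^+ 2 = n%:R * (4 * n%:R ^+ 2 - 1) / 3 :> R.
Proof.
elim: n => [|n IHn]; first by rewrite big_ord0 !mul0r.
by rewrite big_ord_recr/= IHn -natr1 natrD natrM; field.
Qed.

Section SumIntegral.
Context d (T : measurableType d) (R : realType).
Variables (mu : {measure set T -> \bar R}) (D : set T).
Variables (I : Type) (s : seq I) (f : I -> T -> R).
Hypotheses (mD : measurable D)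
  (intf : forall i, mu.-integrable D (EFin \o f i)).

Lemma integrable_sum_EFin :
  mu.-integrable D (EFin \o (fun x => \sum_(i <- s) f i x)).
Proof.
rewrite (_ : _ \o _ = (fun x => \sum_(i <- s) (f i x)%:E)%E).
  by apply: integrable_sum => // i _; exact: intf.
by apply/funext => x /=; rewrite sumEFin.
Qed.

Lemma Rintegral_sum :
  \int[mu]_(x in D) (\sum_(i <- s) f i x) =
  \sum_(i <- s) \int[mu]_(x in D) f i x.
Proof.
rewrite /Rintegral; under eq_integral do rewrite -sumEFin.
by rewrite integral_sum// -sum_fine// => i _;
  have := integrable_fin_num mD (intf i).
Qed.

End SumIntegral.

Section TruncatedPolynomial.
Variables (R : realType) (p : {poly R}).
Let mu := @lebesgue_measure R.

Lemma integrable_horner_itv (a b : R) :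
  mu.-integrable `[a, b]%classic (EFin \o horner p).
Proof.
apply: continuous_compact_integrable; first exact: segment_compact.
by apply: continuous_subspaceT => x; exact: continuous_horner.
Qed.

Lemma truncate_restrict (y : R) :
  (fun x : R => (y <= x)%R%:R * p.[x]) = (horner p \_ `[y, +oo[)%classic.
Proof.
apply/funext => x; rewrite patchE mem_setE in_itv/= andbT.
by case: (y <= x); rewrite ?mul1r ?mul0r.
Qed.

Lemma truncate_itv (y : R) : 0 <= y ->
  (`[0, 1] `&` `[y, +oo[ = `[y, 1])%classic.
Proof.
move=> y0; apply/seteqP; split => x /=; rewrite !in_itv/= andbT.
  by case=> /andP[_ ->] ->.
by move=> /andP[yx ->]; rewrite yx (le_trans y0 yx).
Qed.

Lemma integrable_truncate (y : R) : 0 <= y ->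
  mu.-integrable `[0, 1]%classic (fun x => ((y <= x)%R%:R * p.[x])%:E).
Proof.
move=> y0; rewrite (_ : (fun x => _) =
    ((EFin \o horner p) \_ `[y, +oo[)%classic); last first.
  by rewrite restrict_EFin -truncate_restrict.
apply/integrable_restrict => //=.
by rewrite truncate_itv//; exact: integrable_horner_itv.
Qed.

End TruncatedPolynomial.

(** The indicator cuts the domain down to [[y, 1]], where the fundamental theorem of calculus
    applies to [p]. *)
Lemma Rintegral_truncate_deriv (R : realType) (p : {poly R}) (y : R) :
  0 <= y <= 1 ->
  \int[lebesgue_measure]_(x in `[0, 1]%classic)
    ((y <= x)%R%:R * (p^`()%R).[x]) =
  p.[1] - p.[y].
Proof.
move=> /andP[y0]; rewrite truncate_restrict -Rintegral_mkcondr truncate_itv//.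
(* The fundamental theorem is applied on a nondegenerate interval; for [y = 1] the domain is a
   single point and both sides vanish. *)
rewrite le_eqVlt => /predU1P[->|y1].
  by rewrite set_itv1 Rintegral_set1 subrr.
rewrite /Rintegral (@continuous_FTC2 _ _ (horner p))//.
- by apply: continuous_subspaceT => x; exact: continuous_horner.
- split=> [x _||]; first exact: derivable_horner.
  + by apply: cvg_at_right_filter; exact: continuous_horner.
  + by apply: cvg_at_left_filter; exact: continuous_horner.
- by move=> x _; rewrite derivE.
Qed.

Section OrderStatistics.
Variables (R : realType) (n : nat) (Y : 'I_n -> R).

Lemma size_sort_codom : size (sort <=%R (codom Y)) = n.
Proof. by rewrite size_sort size_codom card_ord. Qed.

Lemma order_stat_le (i j : nat) :
  (i <= j < n)%N -> order_stat Y i <= order_stat Y j.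
Proof.
move=> /andP[ij jn]; apply: (sorted_leq_nth le_trans lexx) => //.
- by rewrite sort_sorted//; exact: le_total.
- by rewrite inE size_sort_codom (leq_ltn_trans ij jn).
- by rewrite inE size_sort_codom.
Qed.

Lemma order_stat_codom (i : 'I_n) : exists j, order_stat Y i = Y j.
Proof.
by apply/codomP; rewrite -(mem_sort <=%R) mem_nth// size_sort_codom.
Qed.

(** Sorting only permutes the sample, ties included; this lets [emp_cdf] be written with the order
    statistics. *)
Lemma sum_order_stat (V : nmodType) (g : R -> V) :
  \sum_(i < n) g (Y i) = \sum_(i < n) g (order_stat Y i).
Proof.
transitivity (\sum_(t <- codom Y) g t); first by rewrite big_map big_enum.
rewrite -(perm_big _ (permEl (perm_sort <=%R _)))/= (big_nth 0).
by rewrite size_sort_codom big_mkord.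
Qed.

End OrderStatistics.

Theorem theorem3p4 (R : realType) (n : nat) (Y : 'I_n -> R)
    (n_ge1 : (1 <= n)%N) (Y01 : forall i : 'I_n, 0 <= Y i <= 1) :
  n%:R * omega2 Y =
    1 / (12%:R * n%:R) +
    \sum_(i < n) ((2 * i + 1)%:R / (2 * n)%:R - order_stat Y i) ^+ 2.
Proof.
have n0 : n%:R != 0 :> R by rewrite pnatr_eq0 -lt0n.
have y01 (i : 'I_n) : 0 <= order_stat Y i <= 1.
  by have [j ->] := order_stat_codom Y i.
pose c (i : nat) : R := (2 * i + 1)%:R.
(* In [G^2/n^2 - 2xG/n + x^2] the i-th indicator has coefficient [c i / n^2 - 2x/n]. Its
   antiderivative is [p i], and [q] is that of [x^2]. *)
pose p (i : nat) : {poly R} := (c i / n%:R ^+ 2) *: 'X - n%:R^-1 *: 'X^2.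
pose q : {poly R} := 3^-1 *: 'X^3.
have dpE i x : (p i)^`().[x] = c i / n%:R ^+ 2 - 2 * x / n%:R.
  by rewrite /p !poly.derivE !hornerE /=; field.
have dqE x : q^`().[x] = x ^+ 2.
  by rewrite /q !poly.derivE !hornerE /=; field.
(* The factor [0 <= x] equals 1 here; it gives the [x^2] term the truncated form too, with threshold
   0. *)
have integrandE (x : R) : x \in `[0, 1]%classic ->
    (emp_cdf Y x - unif_cdf x) ^+ 2 =
    (0 <= x)%R%:R * q^`().[x] +
    \sum_(i < n) (order_stat Y i <= x)%R%:R * (p i)^`().[x].
  rewrite mem_setE in_itv/= => /andP[x0 _].
  rewrite x0 mul1r dqE /emp_cdf /unif_cdf.
  rewrite (sum_order_stat Y (fun t => (t <= x)%R%:R)).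
  under [in RHS]eq_bigr do rewrite dpE mulrBr mulrA.
  rewrite sumrB -!mulr_suml -(@sqr_sum_initial_segment R n
    (fun i => order_stat Y i <= x)%R); last first.
    by move=> i j /(order_stat_le Y); exact: le_trans.
  by field.
have -> : omega2 Y = q.[1] - q.[0] +
    \sum_(i < n) ((p i).[1] - (p i).[order_stat Y i]).
  have := @eq_Rintegral _ (measurableTypeR R) R lebesgue_measure
    `[0, 1]%classic _ _ integrandE.
  rewrite -/(omega2 Y) => ->; rewrite RintegralD//; last 2 first.
  - exact: integrable_truncate.
  - apply: integrable_sum_EFin => // i; apply: integrable_truncate.
    by case/andP: (y01 i).
  rewrite Rintegral_truncate_deriv ?lexx ?ler01// Rintegral_sum//; last first.
    by move=> i; apply: integrable_truncate; case/andP: (y01 i).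
  by congr (_ + _); apply: eq_bigr => i _; rewrite Rintegral_truncate_deriv.
(* This is the case where every indicator is 1. *)
have sum_c : \sum_(i < n) c i = n%:R ^+ 2.
  have := @sqr_sum_initial_segment R n xpredT (fun _ _ _ _ => isT).
  by rewrite sumr_const card_ord => ->; under [RHS]eq_bigr do rewrite mul1r.
rewrite mulrDr mulr_sumr.
(* Completing the square in [order_stat Y i] turns [n * (p i(1) - p i(y_i))] into the wanted square
   plus terms free of the sample. *)
rewrite [X in _ + X](eq_bigr (fun i : 'I_n => c i / n%:R - 1 +
    ((c i / (2 * n)%:R - order_stat Y i) ^+ 2 -
     c i ^+ 2 / (4 * n%:R ^+ 2)))); last first.
  by move=> i _; rewrite /p !hornerE natrM /=; field.
(* The sample-free terms add up to [n/3 + (n - n) - (4n^2 - 1)/(12n) = 1/(12n)]. *)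
rewrite !big_split/= !sumrN -!mulr_suml sum_c sum_sqr_odd sumr_const card_ord.
by rewrite /q !hornerE /= -/c; field.
Qed.
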